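(* Let $I$ be a finite interval and let $\xi$ be a modulus on $[0,|I|]$. If $\varphi\in\mathcal{L}_\xi(I)$, then $\varphi^*\in\mathcal{L}_\xi(I)$ and $$\|\varphi^*\|_{\mathcal{L}_\xi(I)}\le\|\varphi\|_{\mathcal{L}_\xi(I)}.$$
   Context: All intervals are finite and of positive length; $|J|$ is Lebesgue measure and $\langle f\rangle_J=\frac1{|J|}\int_J f$. A modulus is a continuous, increasing (in the weak sense, i.e. non-decreasing) function $\xi\colon[0,\infty)\to[0,\infty)$ with $\xi(0)=0$; the restriction of such a function to $[0,T]$ is called a modulus on $[0,T]$. For an interval $I$ and a modulus $\xi$ on $[0,|I|]$, $\mathcal{L}_\xi(I)$ is the class of all measurable, square-integrable functions $\varphi\colon I\to\mathbb{R}$ for which the following quantity is finite: $$\|\varphi\|_{\mathcal{L}_\xi(I)}:=\inf\big\{C>0\colon \langle\varphi^2\rangle_J-\langle\varphi\rangle_J^2\le C^2\xi^2(|J|)\ \text{for all subintervals } J\subset I\big\}.$$ For $I=(a,b)$ and $f\colon I\to\mathbb{R}$ measurable, the decreasing rearrangement of $f$ is the function $f^*$ on $I$ given by $$f^*(t)=\inf\{\lambda\colon |\{s\in I\colon f(s)>\lambda\}|\le t-a\},\qquad t\in I.$$ *)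

(* Defs.v *)
From HB Require Import structures.
From mathcomp Require Import all_boot all_order all_algebra.
From mathcomp Require Import all_classical all_reals all_analysis.
From mathcomp Require Import measurable_realfun.

Set Implicit Arguments.
Unset Strict Implicit.
Unset Printing Implicit Defensive.
Import Order.TTheory GRing.Theory Num.Theory.
Import numFieldNormedType.Exports.

Local Open Scope classical_set_scope.
Local Open Scope ring_scope.

(* The real line with its Lebesgue (not merely Borel) measurable sets: this is
   the domain of [completed_lebesgue_measure].  Its carrier is R, so a set or
   function on R may be read on either type. *)
Notation lebesgueR R :=
  (caratheodory_type (mu_ext (wlength (idfun : R -> R)))).
Notation leb := completed_lebesgue_measure.

Section Definitions.
Context {R : realType}.
Implicit Types (I J : set R) (xi f phi : R -> R) (C t T : R).

Definition finite_interval I : Prop :=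
  is_interval I /\ (0 < leb (I : set (lebesgueR R)) < +oo)%E.

Definition len J : R := fine (leb (J : set (lebesgueR R))).

(* [modulus] and [modulus_on] constrain only the values of xi on [0, +oo[
   and [0, T]; the other values are irrelevant. *)
Definition modulus xi : Prop :=
  [/\ {within `[0, +oo[%classic, continuous xi},
      {in `[0, +oo[ &, {homo xi : x y / x <= y}},
      (forall x, 0 <= x -> 0 <= xi x) &
      xi 0 = 0].

Definition modulus_on T xi : Prop :=
  exists2 eta, modulus eta & {in `[0, T], xi =1 eta}.

Definition avg J f : R :=
  (len J)^-1 * \int[leb]_(x in (J : set (lebesgueR R))) f x.

Definition Lxi_bound xi I phi C : Prop :=
  forall J, finite_interval J -> J `<=` I ->
    avg J (fun x => phi x ^+ 2) - avg J phi ^+ 2 <= C ^+ 2 * xi (len J) ^+ 2.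

(* The value is +oo when no C is admissible. *)
Definition Lxi_norm xi I phi : \bar R :=
  ereal_inf [set C%:E | C in [set C | 0 < C /\ Lxi_bound xi I phi C]].

(* Functions on I are represented by total functions, of which only the values
   on I matter. *)
Definition Lxi xi I phi : Prop :=
  [/\ measurable_fun (I : set (lebesgueR R)) phi,
      leb.-integrable (I : set (lebesgueR R)) (fun x => (phi x ^+ 2)%:E) &
      (Lxi_norm xi I phi < +oo)%E].

(* [inf I] is the left endpoint a of I.  For measurable f and t in the interior
   of I the set below is nonempty and bounded below; it may fail to be so only
   when t is an endpoint belonging to I, and then [inf] takes a dummy value
   at that single point. *)
Definition rearrangement I f t : R :=
  inf [set l | (leb (I `&` [set s | (l < f s)%R] : set (lebesgueR R))
                <= (t - inf I)%:E)%E].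

End Definitions.

(* Main.v *)
From HB Require Import structures.
Require Import Defs.
From mathcomp Require Import all_boot all_order all_algebra.
From mathcomp Require Import all_classical all_reals all_analysis.
From mathcomp Require Import measurable_realfun ring lra.

(** Fix an admissible constant [C] for [phi] and an interval [J] of length [L].
It has to be shown that the variance of the rearrangement [r] over [J] is at
most [w = C ^+ 2 * xi L ^+ 2]; then every constant admissible for [phi] is
admissible for [r], and the two norms compare.

Shrinking [J] slightly ([cvg_Rintegral_shrink]), assume that its endpoints
[c < d] lie inside [I], and put [M = r c], [m = r d].  Truncating [phi] to
[[m, M]] gives a function [f] whose variance over any interval is at most that
of [phi] ([clamp_variance]).  The truncation of [r] agrees with [r] on [J], is
[M] on its left and [m] on its right.  Since [phi] and [r] have the same
distribution ([distr_rearrangement], [ge0_integral_equimeasurable]), the gap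
[(M - f) (f - m)] has the same integral over [I] as [(M - r) (r - m)] over [J].
If [alpha] is the mean of [r] over [J], the variance of [r] over [J] is
[(M - alpha) (alpha - m)] minus the mean of that last product.  So the claim
becomes the lower bound

  integral over I of (M - f) (f - m) >= ((M - alpha) (alpha - m) - w) L

for the function [f], all of whose variances over intervals of length at most
[L] are at most [w] ([gap_integral_ge]).

Let [F x] be the integral of [f - alpha] up to [x] and [D x] that of the gap.
An interval of length at most [L] over which [f] has mean [alpha], that is,
with [F] equal at both ends, carries gap at least
[kappa = (M - alpha) (alpha - m) - w] per unit of length ([level_chord]).
If one interval of length [L] has mean [alpha], this is the bound.  Otherwise,
by continuity, the mean is on the same side of [alpha] for all of them, say
below it ([chord_bound_total]).
- If [F] reaches its initial level again beyond distance [L], two chords of [F]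
  at that level, both of length at most [L], cover an interval longer than [L],
  and the bound follows.
- If not, start from the last return to the initial level.  From there the
  interval can be traversed by chords at constant level and by short steps along
  which [F] decreases ([descent_chain]).  Along a short step the variance of [f]
  is negligible because [xi] tends to [0] at [0], and the mean is at most
  [alpha], so the gap is at least [kappa / (alpha - m)] times the integral of
  [f - m], up to a small error.  Along a chord the same inequality holds with
  no error.  Adding up, the gap over [I] is at least
  [kappa / (alpha - m)] times the integral of [f - m] over [I], which is at least
  the integral [(alpha - m) L] of [r - m] over [J]
  ([chord_bound_descending]). *)

Set Implicit Arguments.
Unset Strict Implicit.
Unset Printing Implicit Defensive.
Import Order.TTheory GRing.Theory Num.Theory.
Import numFieldNormedType.Exports.
Local Open Scope classical_set_scope.
Local Open Scope ring_scope.

(** * Truncation to a bounded range *)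

Section Clamp.
Context {R : realType}.
Implicit Types m M x y : R.

Definition clamp m M x : R := Num.max m (Num.min x M).

Lemma clamp_ge m M x : m <= clamp m M x.
Proof. by rewrite /clamp le_max lexx. Qed.

Lemma clamp_le m M x : m <= M -> clamp m M x <= M.
Proof. by move=> mM; rewrite /clamp ge_max mM ge_min lexx orbT. Qed.

Lemma clamp_id m M x : m <= x <= M -> clamp m M x = x.
Proof. by move=> /andP[mx xM]; rewrite /clamp min_l// max_r. Qed.

Lemma clamp_eqM m M x : m <= M -> M <= x -> clamp m M x = M.
Proof. by move=> mM Mx; rewrite /clamp min_r// max_r. Qed.

Lemma clamp_eqm m M x : m <= M -> x <= m -> clamp m M x = m.
Proof. by move=> mM xm; rewrite /clamp min_l ?max_l// (le_trans xm). Qed.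

Lemma clamp_dist m M x y : m <= M -> `|clamp m M x - clamp m M y| <= `|x - y|.
Proof.
move=> mM; wlog xy : x y / x <= y.
  move=> wlg; have [|/ltW yx] := leP x y; first exact: wlg.
  by rewrite distrC (distrC x); exact: wlg.
rewrite /clamp /Num.max /Num.min.
rewrite [leRHS]distrC [leLHS]distrC (ger0_norm (_ : 0 <= y - x)) ?subr_ge0//.
by rewrite ler_norml; repeat case: ifPn; rewrite -?leNgt => *; apply/andP; split; lra.
Qed.

Lemma clamp_abs_le m M x : m <= M -> `|clamp m M x| <= `|m| + `|M|.
Proof.
move=> mM; have := clamp_ge m M x; have := clamp_le x mM.
have := ler_norm m; have := ler_norm M; have := ler_norm (- m).
have := ler_norm (- M); rewrite !normrN => *.
by rewrite ler_norml; apply/andP; split; lra.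
Qed.

End Clamp.

(** * Level crossings of a continuous function *)

Section LevelCrossing.
Context {R : realType}.
Implicit Types (F : R -> R) (c u v x y : R).

Lemma last_crossing F u v c : continuous F -> u <= v -> c <= F u -> F v <= c ->
  exists q, [/\ u <= q <= v, F q = c & forall y, q < y <= v -> F y < c].
Proof.
move=> cF uv Fu Fv.
pose S := [set x | u <= x <= v /\ c <= F x].
have Su : S u by rewrite /S /= lexx uv.
have ubS : ubound S v by move=> x [/andP[]].
have hS : has_sup S by split; [exists u|exists v].
have uq : u <= sup S by apply: ub_le_sup => //; exists v.
have qv : sup S <= v by apply: ge_sup => //; exists u.
have above y : sup S < y <= v -> F y < c.
  move=> /andP[qy yv]; rewrite ltNge; apply/negP => cFy.
  have : y <= sup S.
    by apply: ub_le_sup; [exists v|split=> //; rewrite yv andbT (le_trans uq (ltW qy))].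
  by rewrite leNgt qy.
have cFq : c <= F (sup S).
  rewrite leNgt; apply/negP => Fqc.
  have : \forall z \near sup S, F z < c.
    exact: (cvgr_lt _ (cF (sup S))).
  move=> /nbhs_ballP[e /= e0 He].
  have [x [Sx Fx] xq] := sup_adherent e0 hS.
  have xle : x <= sup S by apply: ub_le_sup; [exists v|split].
  have : F x < c by apply: He; rewrite /ball /= ger0_norm ?subr_ge0// ltrBlDl -ltrBlDr.
  by rewrite ltNge Fx.
exists (sup S); split; rewrite ?uq ?qv//.
have cFv : {within `[sup S, v], continuous F} by exact: continuous_subspaceT.
have := IVT qv cFv.
move=> /(_ c); rewrite ge_min le_max Fv cFq/= orbT => /(_ isT)[z].
rewrite in_itv/= => /andP[]; rewrite le_eqVlt => /predU1P[<- //|qz zv Fz].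
by have := above z; rewrite qz zv Fz ltxx => /(_ isT).
Qed.

Lemma first_crossing F u v c : continuous F -> u <= v -> F u <= c -> c <= F v ->
  exists q, [/\ u <= q <= v, F q = c & forall y, u <= y < q -> F y < c].
Proof.
move=> cF uv Fu Fv.
have cF' : continuous (fun x => F (- x)).
  by move=> x; apply: continuous_comp; [exact: opp_continuous|exact: cF].
have [||||q [qv Fq Hq]] := @last_crossing (fun x => F (- x)) (- v) (- u) c;
  rewrite ?opprK ?lerN2//.
exists (- q); split => //; first by rewrite lerNr lerNl andbC.
move=> y /andP[uy yq]; rewrite -(opprK y); apply: Hq.
by rewrite ltrNr yq lerN2.
Qed.

Lemma max_on_interval F u v : continuous F -> u <= v ->
  exists2 y, u <= y <= v & forall z, u <= z <= v -> F z <= F y.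
Proof.
move=> cF uv; have [|y yuv Hy] := @EVT_max R F u v uv.
  exact: continuous_subspaceT.
by exists y; rewrite ?in_itv// in yuv *.
Qed.

End LevelCrossing.

(** * Tiling an interval by chords of a continuous function *)

Section Tiling.
Context {R : realType}.
Implicit Types (F D Psi : R -> R) (a b L m M w alpha x y : R).

(** [F] decreases over every window of length [L], and lies below its value at
[x0] from there on.  The chain alternates a short descending step with a chord of
[F] at constant level; the hypothesis on windows is what keeps these chords
shorter than [L].  The points reached all dominate [F] to their right, and each
round moves by at least [delta], so finitely many rounds reach [b]. *)
Lemma descent_chain F Psi a b L delta x0 :
  continuous F -> 0 < L -> 0 < delta -> a <= x0 -> x0 <= b ->
  (forall s, a <= s -> s + L <= b -> F (s + L) < F s) ->
  (forall x y, a <= x -> x <= y -> y <= b -> y - x <= L -> F x = F y ->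
     Psi x <= Psi y) ->
  (forall x y, a <= x -> x <= y -> y <= b -> y - x <= delta -> F y <= F x ->
     Psi x <= Psi y) ->
  (forall y, x0 <= y <= b -> F y <= F x0) ->
  Psi x0 <= Psi b.
Proof.
move=> cF L0 delta0 ax0 x0b window tile step x0max.
suff chain (n : nat) : exists x, [/\ x0 <= x <= b,
    forall y, x <= y <= b -> F y <= F x, Psi x0 <= Psi x &
    x = b \/ x0 + n%:R * delta <= x].
  have [x [/andP[_ xb] _ Psix]] := chain (Num.trunc ((b - x0) / delta)).+1.
  case=> [<- //|xn]; exfalso.
  have := truncnS_gt ((b - x0) / delta); rewrite ltr_pdivrMr// => h.
  lra.
elim: n => [|n [x [/andP[x0x xb] xmax Psix xn]]].
  by exists x0; split; rewrite ?lexx ?x0b//; right; rewrite mul0r addr0.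
have ax : a <= x by exact: le_trans ax0 x0x.
have [bx|xb'] := leP b (x + delta).
  exists b; split; [by rewrite lexx (le_trans x0x)| | |by left].
    by move=> y; rewrite -eq_le => /eqP <-.
  apply: (le_trans Psix); apply: step => //; first by lra.
  by apply: xmax; rewrite xb lexx.
(* The next point is a maximum [y] of [F] beyond [x + delta]; the step from [x]
   stops at the last [p] before [x + delta] at the level of [y]. *)
have [y /andP[xy yb] ymax] := max_on_interval cF (ltW xb').
have [|||p [/andP[xp pd] Fp pbelow]] := @last_crossing R F x (x + delta) (F y) cF.
- by lra.
- by apply: xmax; rewrite yb andbT; lra.
- by apply: ymax; rewrite lexx ltW.
(* If the chord were too long, [F (y - L)] would exceed [F y], but [F] stays
   below that level after [p]. *)
have yp : y - p <= L.
  rewrite leNgt; apply/negP => Lyp.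
  have Fz : F y < F (y - L).
    by have := window (y - L); rewrite subrK; apply => //; lra.
  have [zd|dz] := leP (y - L) (x + delta).
    by have := pbelow (y - L); rewrite zd andbT => /(_ _); lra.
  have := ymax (y - L); rewrite (ltW dz)/= => /(_ _); lra.
exists y; split.
- by rewrite yb andbT; lra.
- by move=> z /andP[yz zb]; apply: ymax; rewrite zb andbT; exact: le_trans yz.
- apply: (le_trans Psix); apply: (@le_trans _ _ (Psi p)).
    apply: step => //; try lra.
    by rewrite Fp; apply: xmax; rewrite yb andbT; lra.
  by apply: tile => //; lra.
- right; case: xn => [xb''|xn]; first by lra.
  by rewrite -natr1 mulrDl mul1r; lra.
Qed.

(** The upper bound [w] on the variance of a function [f], with values in
[[m, M]], over the intervals of length at most [L], where [p = M - alpha],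
[q = alpha - m], [F] is a primitive of [f - alpha] and [D] a primitive of
[(M - f) (f - m)].  Both sides are multiplied by the squared length, to avoid
divisions. *)
Definition chord_bound F D p q a b w L := forall x y,
  a <= x -> x <= y -> y <= b -> y - x <= L ->
  (p * (y - x) - (F y - F x)) * (q * (y - x) + (F y - F x)) - w * (y - x) ^+ 2
    <= (y - x) * (D y - D x).

(** Reflecting the values, [f] to [- f], exchanges [p] and [q]. *)
Lemma chord_boundN F D p q a b w L :
  chord_bound F D p q a b w L -> chord_bound (fun x => - F x) D q p a b w L.
Proof.
move=> h x y ax xy yb yxL; apply: le_trans (h x y ax xy yb yxL).
by rewrite le_eqVlt; apply/orP; left; apply/eqP; ring.
Qed.

Lemma level_chord F D p q a b w L x y : chord_bound F D p q a b w L ->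
  a <= x -> x <= y -> y <= b -> y - x <= L -> F x = F y ->
  (p * q - w) * (y - x) <= D y - D x.
Proof.
move=> h ax xy yb yxL Fxy; have := h x y ax xy yb yxL.
rewrite Fxy subrr subr0 addr0; move: xy; rewrite le_eqVlt.
move=> /predU1P[->|xy]; first by move=> _; rewrite !subrr mulr0.
rewrite (_ : _ - _ = (y - x) * ((p * q - w) * (y - x))); last by ring.
by rewrite ler_pM2l// subr_gt0.
Qed.

(** The case where the mean over every window of length [L] is below [alpha].
The hypothesis on all [eta] says that small intervals have small variance; it
replaces Lebesgue differentiation on the part of the interval that is not covered
by chords. *)
Lemma chord_bound_descending F D p q a b w L :
  continuous F -> {in `[a, b] &, {homo D : x y / x <= y}} ->
  0 < L -> a + L <= b -> 0 < q -> 0 <= w -> w <= p * q ->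
  chord_bound F D p q a b w L ->
  (forall eta, 0 < eta -> exists2 delta, 0 < delta &
     chord_bound F D p q a b eta delta) ->
  (forall x y, a <= x -> x <= y -> y <= b ->
     0 <= q * (y - x) + (F y - F x)) ->
  q * L <= q * (b - a) + (F b - F a) ->
  (forall s, a <= s -> s + L <= b -> F (s + L) < F s) ->
  (p * q - w) * L <= D b - D a.
Proof.
move=> cF ndD L0 aLb q0 w0 wpq large small slope total window.
have ab : a <= b by lra.
have [|||r [/andP[ar raL] Fr rbelow]] := @last_crossing R F a (a + L) (F a) cF.
- lra.
- by [].
- by apply/ltW/window.
have tile x y : a <= x -> x <= y -> y <= b -> y - x <= L -> F x = F y ->
    (p * q - w) * (y - x) <= D y - D x by exact: level_chord large.
have Dar : (p * q - w) * (r - a) <= D r - D a.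
  by apply: tile => //; lra.
(* A return to the level of [a] beyond distance [L]: two chords suffice. *)
have [[y /andP[aLy yb] Fay]|nohigh] :=
  pselect (exists2 y, a + L <= y <= b & F a <= F y).
  have [|||b' [/andP[aLb' b'y] Fb' belowb']] :=
    @first_crossing R F (a + L) y (F a) cF => //.
    by apply/ltW/window.
  (* Otherwise [b' - L] lies strictly between [r] and [b'], where [F] is below the
     common level, although [F] has to decrease from [b' - L] to [b']. *)
  have b'L : b' - r <= L.
    rewrite leNgt; apply/negP => rb'L.
    have F1 : F (b' - L + L) < F (b' - L) by apply: window; lra.
    rewrite subrK Fb' in F1.
    have [h|h] := leP (b' - L) (a + L).
      by have := rbelow (b' - L); rewrite h andbT => /(_ _); lra.
    by have := belowb' (b' - L); rewrite (ltW h)/= => /(_ _); lra.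
  have Drb' : (p * q - w) * (b' - r) <= D b' - D r.
    by apply: tile; rewrite ?Fr ?Fb' //; lra.
  have Db'b : D b' <= D b.
    by apply: ndD; rewrite ?in_itv/=; lra.
  have : (p * q - w) * L <= (p * q - w) * (b' - a).
    by apply: ler_wpM2l; lra.
  lra.
have belowr y : r <= y <= b -> F y <= F r.
  move=> /andP[ry yb]; rewrite Fr.
  have [h|h] := leP y (a + L).
    move: ry; rewrite le_eqVlt => /predU1P[<-|ry]; first by rewrite Fr.
    by apply/ltW/rbelow; rewrite ry.
  rewrite leNgt; apply/negP => Fay; apply: nohigh.
  by exists y; rewrite ?yb ?(ltW h) ?ltW.
(* A chord with mean [alpha] has gap [p * q - w = lam * q] per unit of length,
   which is [lam] times the integral of [f - m]; since [lam <= p], descending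
   steps satisfy the same lower bound.  [Psi] below collects it. *)
pose lam := (p * q - w) / q.
have lamq : lam * q = p * q - w by rewrite /lam mulfVK// gt_eqF.
have lam0 : 0 <= lam by rewrite divr_ge0//; lra.
have lamp : lam <= p by rewrite ler_pdivrMr//; lra.
suff approx eta : 0 < eta ->
    (p * q - w) * L <= D b - D a + eta * (b - a).
  apply/ler_addgt0Pr => e e0.
  have ba0 : 0 < b - a by lra.
  have := approx (e / (b - a)); rewrite divr_gt0// mulfVK ?gt_eqF//.
  exact.
move=> eta0; have [delta delta0 short] := small _ eta0.
pose Psi x := D x - lam * (F x + q * x) + eta * x.
have rb : r <= b by lra.
have tilePsi x y : a <= x -> x <= y -> y <= b -> y - x <= L -> F x = F y ->
    Psi x <= Psi y.
  move=> ax xy yb yxL Fxy; have := tile x y ax xy yb yxL Fxy.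
  rewrite /Psi Fxy -lamq.
  have : 0 <= eta * (y - x) by rewrite mulr_ge0 ?subr_ge0// ltW.
  nra.
have stepPsi x y : a <= x -> x <= y -> y <= b -> y - x <= delta ->
    F y <= F x -> Psi x <= Psi y.
  move=> ax xy yb yxd Fyx.
  move: (xy); rewrite le_eqVlt => /predU1P[->//|xlty].
  have yx0 : 0 < y - x by rewrite subr_gt0.
  have sl := slope x y ax xy yb.
  have := short x y ax xy yb yxd.
  set l := y - x in yx0 sl *; set A := F y - F x in sl *.
  have h1 : lam * l * (q * l + A) <= (p * l - A) * (q * l + A).
    apply: ler_wpM2r => //.
    have : lam * l <= p * l by apply: ler_wpM2r => //; exact: ltW.
    by rewrite /A; lra.
  move=> h2; have : l * (lam * (q * l + A) - eta * l) <= l * (D y - D x).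
    by rewrite (_ : l * _ = lam * l * (q * l + A) - eta * l ^+ 2); [lra|ring].
  rewrite ler_pM2l// => h3; rewrite /Psi -subr_ge0.
  rewrite [leRHS](_ : _ = D y - D x - (lam * (q * l + A) - eta * l)); first by lra.
  by rewrite /l /A; ring.
have := @descent_chain F Psi a b L delta r cF L0 delta0 ar rb window
  tilePsi stepPsi belowr.
have := tilePsi a r (lexx a) ar rb _ (esym Fr).
move=> /(_ _)/le_trans h /h {}h.
have {}h : Psi a <= Psi b by apply: h; lra.
move: h; rewrite /Psi -lamq.
have : lam * (q * L) <= lam * (q * (b - a) + (F b - F a)) by exact: ler_wpM2l.
lra.
Qed.

(** If no window of length [L] has mean exactly [alpha], continuity forces all
of them to the same side, and reflecting the values reduces to means below
[alpha]. *)
Lemma chord_bound_total F D p q a b w L :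
  continuous F -> {in `[a, b] &, {homo D : x y / x <= y}} ->
  0 < L -> a + L <= b -> 0 < p -> 0 < q -> 0 <= w ->
  chord_bound F D p q a b w L ->
  (forall eta, 0 < eta -> exists2 delta, 0 < delta &
     chord_bound F D p q a b eta delta) ->
  (forall x y, a <= x -> x <= y -> y <= b ->
     - (q * (y - x)) <= F y - F x <= p * (y - x)) ->
  q * L <= q * (b - a) + (F b - F a) ->
  p * L <= p * (b - a) - (F b - F a) ->
  (p * q - w) * L <= D b - D a.
Proof.
move=> cF ndD L0 aLb p0 q0 w0 large small slope totalq totalp.
have ab : a <= b by lra.
have [wpq|pqw] := leP w (p * q); last first.
  have : (p * q - w) * L <= 0 by rewrite mulr_le0_ge0//; lra.
  have : D a <= D b by apply: ndD => //; rewrite in_itv/= lexx ab.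
  lra.
have [[s [as_ sb] Fs]|nolevel] :=
    pselect (exists2 s, a <= s /\ s + L <= b & F s = F (s + L)).
  have := level_chord large as_ _ sb _ Fs.
  rewrite addrAC subrr add0r lexx lerDl => /(_ (ltW L0) isT).
  have : D a <= D s by apply: ndD; rewrite ?in_itv/=; lra.
  have : D (s + L) <= D b by apply: ndD; rewrite ?in_itv/=; lra.
  lra.
pose G x := F (x + L) - F x.
have cG : continuous G.
  move=> x; apply: cvgB; last exact: cF.
  apply: (@continuous_comp _ _ _ (fun x => x + L) F); last exact: cF.
  by apply: cvgD; [exact: cvg_id|exact: cvg_cst].
have signG s t : a <= s -> s + L <= b -> a <= t -> t + L <= b ->
    G s <= 0 -> 0 <= G t -> False.
  move=> as_ sb at_ tb Gs Gt; apply: nolevel.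
  have root r : a <= r -> r + L <= b -> G r = 0 ->
      exists2 s, a <= s /\ s + L <= b & F s = F (s + L).
    by move=> ar rb /subr0_eq Gr; exists r.
  have [st|/ltW ts] := leP s t.
    have [r [/andP[sr rt] Gr _]] := first_crossing cG st Gs Gt.
    by apply: root Gr; lra.
  have [r [/andP[tr rs] Gr _]] := last_crossing cG ts Gt Gs.
  by apply: root Gr; lra.
have [Ga|Ga] := leP (G a) 0.
  apply: (chord_bound_descending cF ndD L0 aLb q0 w0 wpq large small) => //.
    by move=> x y ax xy yb; have := slope x y ax xy yb; lra.
  move=> s as_ sb; rewrite -subr_lt0 ltNge; apply/negP => Gs.
  exact: (signG a s).
rewrite (mulrC p); apply: (@chord_bound_descending (fun x => - F x) D q p) => //.
- by move=> x; apply: cvgN; exact: cF.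
- by rewrite mulrC.
- exact: chord_boundN.
- by move=> eta /small[delta delta0 /chord_boundN]; exists delta.
- by move=> x y ax xy yb; have := slope x y ax xy yb; lra.
- by rewrite -opprD.
- move=> s as_ sb; rewrite ltrN2 -subr_gt0 ltNge; apply/negP => Gs.
  by apply: (signG s a) => //; exact: ltW.
Qed.

(** A slope bound on [[a, b]] makes [F] continuous once it is extended by
constants outside [[a, b]]. *)
Lemma chord_bound_lipschitz (F D : R -> R) (p q a b w L : R) :
  {in `[a, b] &, {homo D : x y / x <= y}} ->
  0 < L -> a + L <= b -> 0 < p -> 0 < q -> 0 <= w ->
  chord_bound F D p q a b w L ->
  (forall eta, 0 < eta -> exists2 delta, 0 < delta &
     chord_bound F D p q a b eta delta) ->
  (forall x y, a <= x -> x <= y -> y <= b ->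
     - (q * (y - x)) <= F y - F x <= p * (y - x)) ->
  q * L <= q * (b - a) + (F b - F a) ->
  p * L <= p * (b - a) - (F b - F a) ->
  (p * q - w) * L <= D b - D a.
Proof.
move=> ndD L0 aLb p0 q0 w0 large small slope totalq totalp.
have ab : a <= b by lra.
pose G := F \o clamp a b.
have GE x : a <= x <= b -> G x = F x by move=> h; rewrite /G /= clamp_id.
have chordG e l : chord_bound F D p q a b e l -> chord_bound G D p q a b e l.
  move=> h x y ax xy yb yxl; rewrite !GE; first exact: h.
    by rewrite ax (le_trans xy).
  by rewrite yb (le_trans ax).
have Glip x y : `|G x - G y| <= (p + q) * `|x - y|.
  apply: (@le_trans _ _ ((p + q) * `|clamp a b x - clamp a b y|)); last first.
    by apply: ler_wpM2l (clamp_dist _ _ ab); lra.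
  have := clamp_ge a b x; have := clamp_le x ab.
  have := clamp_ge a b y; have := clamp_le y ab; rewrite /G /=.
  move: (clamp a b x) (clamp a b y); move=> {x y}.
  move=> x y yb ay xb ax.
  wlog xy : x y yb ay xb ax / x <= y.
    move=> wlg; have [|/ltW yx] := leP x y; first exact: wlg.
    by rewrite distrC (distrC x); exact: wlg.
  have := slope x y ax xy yb.
  rewrite distrC (distrC x) (ger0_norm (_ : 0 <= y - x)) ?subr_ge0//.
  by rewrite ler_norml; nra.
have cG : continuous G.
  move=> x; apply/cvgrPdist_le => e e0.
  have pq0 : 0 < p + q by lra.
  near=> t; apply: (le_trans (Glip x t)).
  rewrite mulrC -ler_pdivlMr//; near: t.
  by apply: (@cvgr_dist_le _ _ _ _ _ id x) => //; rewrite divr_gt0.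
rewrite -(GE a) ?lexx// -(GE b) ?lexx ?andbT// in totalq totalp.
apply: (chord_bound_total cG ndD L0 aLb p0 q0 w0 (chordG _ _ large)) => //.
  by move=> eta /small[delta delta0 /chordG]; exists delta.
move=> x y ax xy yb; rewrite !GE; first exact: slope.
  by rewrite ax (le_trans xy).
by rewrite yb (le_trans ax).
Unshelve. all: by end_near. Qed.

End Tiling.

(** * Square integrable functions on a set of finite measure *)

Section SquareIntegrable.
Context d (T : measurableType d) (R : realType).
Context (mu : {measure set T -> \bar R}).
Implicit Types (K : set T) (f g : T -> R).

Definition sq_integrable K f :=
  measurable_fun K f /\ mu.-integrable K (EFin \o (fun x => f x ^+ 2)).

Lemma sq_integrableS K1 K f : measurable K -> measurable K1 -> K1 `<=` K ->
  sq_integrable K f -> sq_integrable K1 f.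
Proof.
move=> mK mK1 K1K [mf if2]; split; first exact: measurable_funS mf.
exact: integrableS if2.
Qed.

Lemma finite_integrable_cst K (c : R) : measurable K -> (mu K < +oo)%E ->
  mu.-integrable K (EFin \o cst c).
Proof.
move=> mK Kfin; apply: measurable_bounded_integrable => //.
exact: bounded_cst.
Qed.

Lemma sq_integrable_integrable K f : measurable K -> (mu K < +oo)%E ->
  sq_integrable K f -> mu.-integrable K (EFin \o f).
Proof.
move=> mK Kfin [mf if2].
apply: (@le_integrable _ _ _ mu K mK _ (EFin \o (fun x => 1 + f x ^+ 2))).
- exact/measurable_EFinP.
- move=> x _ /=; rewrite lee_fin [leRHS]ger0_norm.
    by rewrite -real_normK ?num_real//; nra.
  by rewrite addr_ge0// sqr_ge0.
- rewrite (_ : _ \o _ =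
    ((EFin \o cst 1%R) \+ (EFin \o (fun x => (f x ^+ 2)%R)))%E)//.
  by apply: integrableD => //; exact: finite_integrable_cst.
Qed.

Lemma bounded_integrable K f (B : R) : measurable K -> (mu K < +oo)%E ->
  measurable_fun K f -> (forall x, K x -> `|f x| <= B) ->
  mu.-integrable K (EFin \o f).
Proof.
move=> mK Kfin mf fB; apply: measurable_bounded_integrable => //.
exists B; split; first exact: num_real.
by move=> C BC x Kx; apply: le_trans (fB x Kx) (ltW BC).
Qed.

Lemma bounded_sq_integrable K f (B : R) : measurable K -> (mu K < +oo)%E ->
  measurable_fun K f -> (forall x, K x -> `|f x| <= B) -> sq_integrable K f.
Proof.
move=> mK Kfin mf fB; split => //.
apply: (@bounded_integrable _ _ (B ^+ 2)) => //.
  by apply: measurable_funX.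
move=> x Kx; rewrite normrX lerXn2r ?nnegrE ?fB//.
by rewrite (le_trans _ (fB x Kx)).
Qed.

Lemma quadratic_integrable K f (u v w : R) : measurable K -> (mu K < +oo)%E ->
  sq_integrable K f ->
  mu.-integrable K (EFin \o (fun x => u * f x ^+ 2 + v * f x + w)).
Proof.
move=> mK Kfin sf; have if1 := sq_integrable_integrable mK Kfin sf.
have iu := integrableZl mK u sf.2; have iv := integrableZl mK v if1.
have iw := finite_integrable_cst w mK Kfin.
exact: (integrableD mK (integrableD mK iu iv) iw).
Qed.

Lemma Rintegral_quadratic K f (u v w l : R) : measurable K -> mu K = l%:E ->
  sq_integrable K f ->
  \int[mu]_(x in K) (u * f x ^+ 2 + v * f x + w) =
  u * \int[mu]_(x in K) (f x ^+ 2) + v * \int[mu]_(x in K) f x + w * l.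
Proof.
move=> mK Kl sf; have Kfin : (mu K < +oo)%E by rewrite Kl ltry.
have if1 := sq_integrable_integrable mK Kfin sf.
have iu : mu.-integrable K (EFin \o (fun x => u * f x ^+ 2)).
  exact: (integrableZl mK u sf.2).
have iv : mu.-integrable K (EFin \o (fun x => v * f x)).
  exact: (integrableZl mK v if1).
rewrite RintegralD//=; last exact: finite_integrable_cst.
  rewrite RintegralD// RintegralZl// ?RintegralZl//; last exact: sf.2.
  by rewrite Rintegral_cst// Kl.
exact: (integrableD mK iu iv).
Qed.

(** Truncation is 1-Lipschitz, so the mean square distance of the truncated
function to the truncated mean of [f] is at most the variance of [f]; and the
variance is the least mean square distance to a constant. *)
Lemma clamp_variance K f (m M l : R) : measurable K -> mu K = l%:E -> 0 < l ->
  m <= M -> sq_integrable K f ->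
  l * \int[mu]_(x in K) (clamp m M (f x) ^+ 2)
    - (\int[mu]_(x in K) clamp m M (f x)) ^+ 2 <=
  l * \int[mu]_(x in K) (f x ^+ 2) - (\int[mu]_(x in K) f x) ^+ 2.
Proof.
move=> mK Kl l0 mM sf; have Kfin : (mu K < +oo)%E by rewrite Kl ltry.
have [mf if2] := sf.
have sg : sq_integrable K (clamp m M \o f).
  apply: (@bounded_sq_integrable _ _ (`|m| + `|M|)) => //.
    by apply: measurable_maxr => //; apply: measurable_minr.
  by move=> x _ /=; exact: clamp_abs_le.
set P1 := \int[mu]_(x in K) f x.
set P2 := \int[mu]_(x in K) (f x ^+ 2).
set B1 := \int[mu]_(x in K) clamp m M (f x).
set B2 := \int[mu]_(x in K) (clamp m M (f x) ^+ 2).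
pose c := P1 / l; pose e := clamp m M c.
have := @le_Rintegral _ _ _ mu K
  (fun x => 1 * clamp m M (f x) ^+ 2 + (- (2 * e)) * clamp m M (f x) + e ^+ 2)
  (fun x => 1 * f x ^+ 2 + (- (2 * c)) * f x + c ^+ 2) mK.
rewrite (Rintegral_quadratic _ _ _ mK Kl sg)
  (Rintegral_quadratic _ _ _ mK Kl sf).
rewrite -/P1 -/P2 -/B1 -/B2 !mul1r.
move=> /(_ (quadratic_integrable _ _ _ mK Kfin sg)
  (quadratic_integrable _ _ _ mK Kfin sf)) h.
have {h} : B2 + - (2 * e) * B1 + e ^+ 2 * l <= P2 + - (2 * c) * P1 + c ^+ 2 * l.
  apply: h => x _.
  rewrite [leLHS](_ : _ = (clamp m M (f x) - e) ^+ 2); last by ring.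
  rewrite [leRHS](_ : _ = (f x - c) ^+ 2); last by ring.
  rewrite -[leLHS]real_normK ?num_real// -[leRHS]real_normK ?num_real//.
  by rewrite lerXn2r ?nnegrE//; exact: clamp_dist.
have cl : c * l = P1 by rewrite /c divfK// gt_eqF.
move=> /(ler_wpM2l (ltW l0)).
rewrite [X in _ <= X](_ : _ = l * P2 - P1 ^+ 2); last by rewrite -cl; ring.
apply: le_trans; rewrite -subr_ge0.
rewrite [leRHS](_ : _ = (B1 - e * l) ^+ 2); last by ring.
exact: sqr_ge0.
Qed.

(** The upward rays are stable under intersection and generate the Borel
sets. *)
Lemma measure_eq_rays (m1 m2 : {measure set R -> \bar R}) :
  (m1 setT < +oo)%E ->
  (forall l : R, m1 `]l, +oo[%classic = m2 `]l, +oo[%classic) ->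
  forall B, measurable B -> m1 B = m2 B.
Proof.
move=> m1fin rays; apply: (measure_unique (@RGenOInfty.G R)
  (fun k : nat => `](- k%:R), +oo[%classic)).
- exact: RGenOInfty.measurableE.
- move=> _ _ [x ->] [y ->]; exists (Num.max x y).
  by apply/seteqP; split => z; rewrite /= !in_itv/= !andbT gt_max => /andP.
- by move=> k; exists (- k%:R).
- rewrite -subTset => x _; exists (Num.trunc `|x|).+1 => //=.
  rewrite in_itv/= andbT ltrNl; apply: le_lt_trans (truncnS_gt _).
  by rewrite -normrN ler_norm.
- by move=> _ [l ->]; exact: rays.
- move=> k; apply: le_lt_trans m1fin.
  by apply: le_measure; rewrite ?inE.
Qed.

(** Both integrals are taken against the law of the function under the
restriction of [mu] to [K], and the law is determined by the measures of the
superlevel sets. *)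
Lemma ge0_integral_equimeasurable K f g (Psi : R -> R) :
  measurable K -> (mu K < +oo)%E -> measurable_fun K f -> measurable_fun K g ->
  (forall l, mu (K `&` [set x | l < f x]) = mu (K `&` [set x | l < g x])) ->
  measurable_fun setT Psi -> (forall y, 0 <= Psi y) ->
  (\int[mu]_(x in K) (Psi (f x))%:E = \int[mu]_(x in K) (Psi (g x))%:E)%E.
Proof.
move=> mK Kfin mf mg fg mPsi Psi0.
(* Extending by [0] outside [K] makes the functions measurable everywhere; the
   complement of [K] is negligible for [nu]. *)
pose nu : {measure set T -> \bar R} := mrestr mu mK.
have mpatch h : measurable_fun K h ->
    exists2 H : {mfun T >-> R}, H =1 (h \_ K) &
     forall l : R, nu (H @^-1` `]l, +oo[) = mu (K `&` [set x | l < h x]).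
  move=> mh; have mh' : measurable_fun setT (h \_ K : T -> R).
    exact/(measurable_restrictT _ mK).1.
  pose H : {mfun T >-> R} :=
    HB.pack (h \_ K : T -> R)
      (isMeasurableFun.Build _ _ _ _ _ mh').
  exists H => // l; rewrite /nu /= /mrestr; congr (mu _).
  apply/seteqP; split=> x /=.
    by rewrite in_itv/= andbT => -[+ Kx]; rewrite patchE mem_set.
  by rewrite in_itv/= andbT => -[Kx +]; rewrite patchE mem_set.
have transfer h (H : {mfun T >-> R}) : H =1 (h \_ K) ->
    (\int[mu]_(x in K) (Psi (h x))%:E = \int[pushforward nu H]_y (Psi y)%:E)%E.
  move=> Hh; rewrite [RHS]ge0_integral_pushforward//=; last 2 first.
  - exact/measurable_EFinP.
  - by move=> y _; rewrite lee_fin.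
  rewrite preimage_setT (@ge0_negligible_integral _ _ _ nu setT (~` K) _
    (measurableC mK) measurableT); last 3 first.
  - by apply/measurable_EFinP; exact: (measurableT_comp mPsi).
  - by move=> y _; rewrite lee_fin.
  - by rewrite /nu /= /mrestr setICl measure0.
  rewrite setDE setCK setTI.
  rewrite [LHS](@eq_measure_integral _ _ _ K nu mu)//.
    by apply: eq_integral => x xK; rewrite /= Hh patchE xK.
  by move=> A mA AK; rewrite /nu /= /mrestr setIidl.
have [F FE Frays] := mpatch f mf; have [G GE Grays] := mpatch g mg.
rewrite (transfer f F FE) (transfer g G GE).
apply: eq_measure_integral => B mB _.
apply: (@measure_eq_rays (pushforward nu F) (pushforward nu G)) => //; last first.
  by move=> l; exact: etrans (Frays l) (etrans (fg l) (esym (Grays l))).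
by suff: (mu ((F @^-1` setT) `&` K) < +oo)%E by []; rewrite preimage_setT setTI.
Qed.

End SquareIntegrable.

(** * Integrals over intervals of the line *)

Section LebesgueIntervals.
Context {R : realType}.
Local Notation mu := (@completed_lebesgue_measure R).
Local Notation LR := (lebesgueR R).
Implicit Types (I J : set R) (a b c x y : R) (g phi : R -> R).

Local Notation oo x y := (`]x, y[%classic : set LR).

Lemma measurable_leb I : measurable I -> measurable (I : set LR).
Proof. exact: sub_caratheodory. Qed.

Lemma measurable_oo x y : measurable (oo x y).
Proof. exact: measurable_leb. Qed.

Lemma leb_itv (i : interval R) :
  mu [set` i] = if (i.1 < i.2)%E then (i.2 - i.1)%E else 0%E.
Proof. exact: lebesgue_measure_itv. Qed.

Lemma leb_oo x y : x <= y -> mu (oo x y) = (y - x)%:E.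
Proof.
move=> xy; rewrite leb_itv/= lte_fin; case: ltP => // yx.
by rewrite (_ : y = x) ?subrr//; apply/eqP; rewrite eq_le yx xy.
Qed.

Lemma leb_oo_fin x y : x <= y -> (mu (oo x y) < +oo)%E.
Proof. by move=> /leb_oo ->; rewrite ltry. Qed.

Lemma len_oo x y : x <= y -> len `]x, y[ = y - x.
Proof. by move=> xy; rewrite /len leb_oo. Qed.

Lemma finite_interval_oo x y : x < y -> finite_interval (`]x, y[%classic : set R).
Proof.
move=> xy; split; first exact: interval_is_interval.
by rewrite leb_oo ?(ltW xy)// lte_fin subr_gt0 xy ltry.
Qed.

Lemma leb_set1 x : mu ([set x] : set LR) = 0%E.
Proof. by rewrite -set_itv1 leb_itv /= lte_fin ltxx. Qed.

Lemma leb_set2 x y : mu ([set x; y] : set LR) = 0%E.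
Proof.
apply/eqP; rewrite eq_le measure_ge0 andbT.
apply: (@le_trans _ _ (mu ([set x] : set R) + mu ([set y] : set R))%E).
  by apply: measureU2; exact: measurable_leb.
by rewrite !leb_set1 adde0.
Qed.

(** An infinite end would make the measure infinite.  The endpoints may or may
not belong to [I], hence the two inclusions. *)
Lemma finite_interval_ends I : finite_interval I -> exists a b,
  [/\ a < b, (`]a, b[ `<=` I)%classic, (I `<=` `[a, b])%classic,
      inf I = a & len I = b - a].
Proof.
move=> [/is_intervalP IE]; rewrite IE; move: (Rhull I) => {IE}.
case=> [[ba a|[|]] [bb b|[|]]]; rewrite leb_itv/= ?lte_fin ?ltxx ?ltry//=.
- have [ab|] := ltP a b; last by rewrite ltxx.
  move=> _; exists a, b; split => //.
  + move=> x /=; case: (ba); case: (bb); rewrite !in_itv/= => /andP[h1 h2];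
      first [by rewrite h1 h2|by rewrite (ltW h1) h2|by rewrite h1 (ltW h2)|
             by rewrite (ltW h1) (ltW h2)].
  + move=> x /=; case: (ba); case: (bb); rewrite !in_itv/= => /andP[h1 h2];
      first [by rewrite h1 h2|by rewrite (ltW h1) h2|by rewrite h1 (ltW h2)|
             by rewrite (ltW h1) (ltW h2)].
  + by apply: inf_itv; case: (ba); case: (bb); rewrite bnd_simp ?ltW.
  + by rewrite /len leb_itv/= lte_fin ab.
- by rewrite ltNyr addey ?ltxx ?andbF.
Qed.

Lemma oo_interior I a b : (`]a, b[ `<=` I)%classic -> (I `<=` `[a, b])%classic ->
  I `\` [set a; b] = `]a, b[%classic.
Proof.
move=> sub1 sub2; apply/seteqP; split=> x /=.
  move=> [/sub2 /=]; rewrite !in_itv/= => /andP[ax xb] /not_orP[/eqP xa /eqP xb'].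
  by rewrite !lt_neqAle ax xb eq_sym xa xb'.
move=> xab; split; first exact: sub1.
by move: xab; rewrite in_itv/= => /[swap] -[->|->]; rewrite ltxx ?andbF.
Qed.

Lemma Rintegral_interior I a b g : measurable (I : set LR) ->
  (`]a, b[ `<=` I)%classic -> (I `<=` `[a, b])%classic ->
  mu.-integrable (I : set LR) (EFin \o g) ->
  \int[mu]_(x in (I : set LR)) g x = \int[mu]_(x in oo a b) g x.
Proof.
move=> mI sub1 sub2 ig; rewrite -(oo_interior sub1 sub2) /Rintegral; congr fine.
apply: negligible_integral => //; last exact: leb_set2.
by apply: measurableU; apply: measurable_leb.
Qed.

(** The point [x] is missing on the right, which changes nothing since it is
negligible. *)
Lemma Rintegral_split a b x y g : a <= x -> x <= y -> y <= b ->
  mu.-integrable (oo a b) (EFin \o g) ->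
  \int[mu]_(t in oo a y) g t =
  \int[mu]_(t in oo a x) g t + \int[mu]_(t in oo x y) g t.
Proof.
move=> ax xy yb ig.
have ayab : oo a y `<=` oo a b.
  by move=> t /=; rewrite !in_itv/= => /andP[-> /=] /lt_le_trans; apply.
have iay : mu.-integrable (oo a y) (EFin \o g).
  by apply: integrableS ayab ig; exact: measurable_oo.
have split2 : oo a y `\` [set x] = oo a x `|` oo x y.
  apply/seteqP; split=> t /=; rewrite !in_itv/=.
    move=> [/andP[at_ ty] /eqP tx]; have [tx'|xt|tx'] := ltgtP t x.
    - by left; rewrite at_.
    - by right; rewrite ty.
    - by rewrite tx' eqxx in tx.
  move=> [/andP[h1 h2]|/andP[h1 h2]]; split.
  - by rewrite h1 (lt_le_trans h2).
  - by move=> tx; rewrite tx ltxx in h2.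
  - by rewrite h2 (le_lt_trans ax).
  - by move=> tx; rewrite tx ltxx in h1.
rewrite -Rintegral_setU//; try exact: measurable_oo.
- rewrite -split2 /Rintegral; congr fine; apply: negligible_integral => //.
  + exact: measurable_leb.
  + exact: measurable_oo.
  + exact: leb_set1.
- rewrite -split2; apply: integrableS iay; first exact: measurable_oo.
    by apply: measurableD; [exact: measurable_oo|exact: measurable_leb].
  by move=> t [].
- apply/disj_setPS => t /= []; rewrite !in_itv/= => /andP[_ h1] /andP[h2 _].
  by have := lt_trans h1 h2; rewrite ltxx.
Qed.

End LebesgueIntervals.

(** * Oscillation of a truncated function *)

Section Oscillation.
Context {R : realType}.
Local Notation mu := (@completed_lebesgue_measure R).
Local Notation LR := (lebesgueR R).
Implicit Types (I J : set R) (a b c x y : R) (g phi : R -> R).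

Local Notation oo x y := (`]x, y[%classic : set LR).

(** The variance bound of the Campanato class over windows of length at most
[L], multiplied by the squared length. *)
Definition osc_bound a b phi L w := forall x y,
  a <= x -> x < y -> y <= b -> y - x <= L ->
  (y - x) * \int[mu]_(t in oo x y) (phi t ^+ 2)
    - (\int[mu]_(t in oo x y) phi t) ^+ 2 <= w * (y - x) ^+ 2.

Lemma measurable_clamp (m M : R) : measurable_fun setT (clamp m M).
Proof. by apply: measurable_maxr => //; apply: measurable_minr. Qed.

Lemma sq_integrable_clamp a b phi (m M : R) : a <= b -> m <= M ->
  sq_integrable mu (oo a b) phi -> sq_integrable mu (oo a b) (clamp m M \o phi).
Proof.
move=> ab mM [mphi _]; apply: (@bounded_sq_integrable _ _ _ _ _ _ (`|m| + `|M|)).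
- exact: measurable_oo.
- exact: leb_oo_fin.
- exact: measurableT_comp (measurable_clamp m M) mphi.
- by move=> x _ /=; exact: clamp_abs_le.
Qed.

Lemma clamp_osc_bound a b phi (m M L w : R) : m <= M ->
  sq_integrable mu (oo a b) phi ->
  osc_bound a b phi L w -> osc_bound a b (clamp m M \o phi) L w.
Proof.
move=> mM sphi osc x y ax xy yb yxL; apply: le_trans (osc x y ax xy yb yxL).
have sub : oo x y `<=` oo a b.
  move=> t /=; rewrite !in_itv/= => /andP[h1 h2].
  by rewrite (le_lt_trans ax)// (lt_le_trans h2).
apply: (clamp_variance (measurable_oo x y) (leb_oo (ltW xy))) => //.
  by rewrite subr_gt0.
by apply: sq_integrableS sphi => //; exact: measurable_oo.
Qed.

(** Expanding [(M - phi) (phi - m)] expresses the gap through the first two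
moments of [phi], which turns the variance bound into [chord_bound]. *)
Lemma osc_bound_chord a b phi (m M alpha L w : R) :
  sq_integrable mu (oo a b) phi -> osc_bound a b phi L w ->
  chord_bound (fun x => \int[mu]_(t in oo a x) phi t - alpha * x)
    (fun x => \int[mu]_(t in oo a x) ((M - phi t) * (phi t - m)))
    (M - alpha) (alpha - m) a b w L.
Proof.
move=> sphi osc x y ax xy yb yxL.
move: xy; rewrite le_eqVlt => /predU1P[->|xy].
  by rewrite !subrr !mulr0 expr0n/= mulr0 subrr mul0r.
have xy' := ltW xy; have ab : a <= b by rewrite (le_trans ax)// (le_trans xy').
have sub : oo x y `<=` oo a b.
  move=> t /=; rewrite !in_itv/= => /andP[h1 h2].
  by rewrite (le_lt_trans ax)// (lt_le_trans h2).
have prodE (t : R) : (M - phi t) * (phi t - m) =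
  - 1 * phi t ^+ 2 + (M + m) * phi t + - (M * m) by ring.
have moo := @measurable_oo R.
under [X in _ <= _ * (X - _)]eq_Rintegral do rewrite prodE.
under [X in _ <= _ * (_ - X)]eq_Rintegral do rewrite prodE.
rewrite (@Rintegral_split _ a b x y phi)//; last first.
  by apply: sq_integrable_integrable sphi => //; exact: leb_oo_fin.
rewrite (@Rintegral_split _ a b x y (fun t => _ + _))//; last first.
  by apply: quadratic_integrable => //; exact: leb_oo_fin.
rewrite [X in _ <= _ * (_ + X - _)](Rintegral_quadratic _ _ _ _ (leb_oo xy'))//;
  last exact: sq_integrableS sphi.
have := osc x y ax xy yb yxL.
move: (\int[mu]_(t in oo a x) phi t) (\int[mu]_(t in oo x y) phi t).
move: (\int[mu]_(t in oo x y) (phi t ^+ 2)) => P2 P0 P1.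
move: (\int[mu]_(_ in _) _) => Q.
rewrite -subr_ge0 => h; rewrite -subr_ge0.
by rewrite [leRHS](_ : _ =  w * (y - x) ^+ 2 - ((y - x) * P2 - P1 ^+ 2)); [|ring].
Qed.

(** The lower bound on the total gap.  The two last hypotheses say that the
truncated function has at least as much mass above [m], and as much missing below
[M], as a function of mean [alpha] on an interval of length [L]; one of them
serves when the windows have means below [alpha], the other when they have means
above. *)
Lemma gap_integral_ge a b phi (m M alpha L w : R) : a < b ->
  sq_integrable mu (oo a b) phi ->
  0 < L -> L <= b - a -> m < alpha -> alpha < M -> 0 <= w ->
  osc_bound a b phi L w ->
  (forall eta, 0 < eta -> exists2 delta, 0 < delta & osc_bound a b phi delta eta) ->
  (alpha - m) * L <= \int[mu]_(t in oo a b) (clamp m M (phi t) - m) ->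
  (M - alpha) * L <= \int[mu]_(t in oo a b) (M - clamp m M (phi t)) ->
  ((M - alpha) * (alpha - m) - w) * L <=
    \int[mu]_(t in oo a b) ((M - clamp m M (phi t)) * (clamp m M (phi t) - m)).
Proof.
move=> ab sphi L0 Lba malpha alphaM w0 osc small totalm totalM.
have mM : m <= M by apply/ltW/(lt_trans malpha).
have ab' := ltW ab.
have sf := sq_integrable_clamp ab' mM sphi.
have {}osc := clamp_osc_bound mM sphi osc.
set f := clamp m M \o phi in sf osc.
pose F x := \int[mu]_(t in oo a x) f t - alpha * x.
pose D x := \int[mu]_(t in oo a x) ((M - f t) * (f t - m)).
have moo := @measurable_oo R.
have aa0 (g : R -> R) : \int[mu]_(t in oo a a) g t = 0.
  by rewrite set_itvoo0 Rintegral_set0.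
have if1 : mu.-integrable (oo a b) (EFin \o f).
  by apply: sq_integrable_integrable sf => //; exact: leb_oo_fin.
have fin := leb_oo_fin.
have iD : mu.-integrable (oo a b) (EFin \o (fun t => (M - f t) * (f t - m))).
  rewrite (_ : (fun t => _) =
    fun t => - 1 * f t ^+ 2 + (M + m) * f t + - (M * m)).
    by apply: quadratic_integrable => //; exact: fin.
  by apply/funext => t; ring.
have Rcst x y c : x <= y -> \int[mu]_(t in oo x y) c = c * (y - x).
  by move=> xy; rewrite Rintegral_cst//; congr (_ * _); exact: len_oo.
have ifs x y : a <= x -> x <= y -> y <= b ->
    mu.-integrable (oo x y) (EFin \o f).
  move=> ax xy yb; apply: integrableS if1 => // t /=; rewrite !in_itv/=.
  by move=> /andP[h1 h2]; rewrite (le_lt_trans ax)// (lt_le_trans h2).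
have icst x y c : x <= y -> mu.-integrable (oo x y) (EFin \o cst c).
  by move=> xy; apply: finite_integrable_cst => //; exact: fin.
have FE x y : a <= x -> x <= y -> y <= b ->
    F y - F x = \int[mu]_(t in oo x y) f t - alpha * (y - x).
  by move=> ax xy yb; rewrite /F (Rintegral_split ax xy yb if1); ring.
suff : ((M - alpha) * (alpha - m) - w) * L <= D b - D a.
  by rewrite /D aa0 subr0.
apply: (@chord_bound_lipschitz _ F) => //.
- move=> x y; rewrite !in_itv/= => /andP[ax xb] /andP[ay yb] xy.
  rewrite /D (Rintegral_split ax xy yb iD) lerDl; apply: Rintegral_ge0 => t _.
  by rewrite mulr_ge0// subr_ge0 /f /= ?clamp_ge ?clamp_le.
- by rewrite -lerBrDl.
- by rewrite subr_gt0.
- by rewrite subr_gt0.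
- exact: osc_bound_chord.
- move=> eta /small[delta delta0 osc']; exists delta => //.
  by apply: osc_bound_chord => //; exact: clamp_osc_bound.
- move=> x y ax xy yb; rewrite FE//.
  have h1 : m * (y - x) <= \int[mu]_(t in oo x y) f t.
    rewrite -Rcst//; apply: le_Rintegral => //; [exact: icst|exact: ifs|].
    by move=> t _; exact: clamp_ge.
  have h2 : \int[mu]_(t in oo x y) f t <= M * (y - x).
    rewrite -Rcst//; apply: le_Rintegral => //; [exact: ifs|exact: icst|].
    by move=> t _; exact: clamp_le.
  move: h1 h2; move: (\int[mu]_(t in oo x y) f t) => B.
  by clear; move=> h1 h2; apply/andP; split; lra.
- move: totalm; rewrite FE// RintegralB//; last exact: icst.
  rewrite Rcst//; rewrite -/(\int[mu]_(t in oo a b) f t).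
  by move: (\int[mu]_(t in oo a b) f t) => B; clear; lra.
- move: totalM; rewrite FE// RintegralB//; last exact: icst.
  rewrite Rcst//; rewrite -/(\int[mu]_(t in oo a b) f t).
  by move: (\int[mu]_(t in oo a b) f t) => B; clear; lra.
Qed.

End Oscillation.

(** * Distribution functions *)

Section Distribution.
Context d (T : measurableType d) (R : realType).
Context (mu : {measure set T -> \bar R}).
Implicit Types (K : set T) (f : T -> R) (l c : R).
Local Open Scope ereal_scope.

Definition distr K f l := mu (K `&` [set x | (l < f x)%R]).

Lemma measurable_superlevel K f l : measurable K -> measurable_fun K f ->
  measurable (K `&` [set x | (l < f x)%R]).
Proof. by move=> mK mf; rewrite -preimage_itvoy; exact: mf. Qed.

Lemma distr_nonincreasing K f l l' : measurable K -> measurable_fun K f ->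
  (l <= l')%R -> distr K f l' <= distr K f l.
Proof.
move=> mK mf ll'; apply: le_measure; rewrite ?inE; try exact: measurable_superlevel.
by move=> x /= [Kx l'x]; split=> //; exact: le_lt_trans l'x.
Qed.

Lemma distr_le K f l : measurable K -> measurable_fun K f ->
  distr K f l <= mu K.
Proof.
move=> mK mf; apply: le_measure; rewrite ?inE//; exact: measurable_superlevel.
Qed.

Lemma distr_lt_top K f c : measurable K -> measurable_fun K f ->
  mu K < +oo -> 0 < c%:E -> exists l, distr K f l <= c%:E.
Proof.
move=> mK mf Kfin c0.
pose F (n : nat) := K `&` [set x | (n%:R < f x)%R].
have F0 : \bigcap_n F n = set0.
  rewrite -subset0 => x Fx; have [_ /=] := Fx (Num.trunc `|f x|).+1 Logic.I.
  have := truncnS_gt `|f x|; have := ler_norm (f x).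
  by move=> h1 h2 h3; have := lt_trans h3 (le_lt_trans h1 h2); rewrite ltxx.
have Fcvg : mu \o F @ \oo --> 0.
  rewrite -(measure0 mu) -F0; apply: nonincreasing_cvg_mu.
  - by apply: le_lt_trans Kfin; exact: distr_le.
  - by move=> n; exact: measurable_superlevel.
  - by rewrite F0.
  - move=> n m nm; apply/subsetPset => x /= [Kx mx]; split=> //.
    by apply: le_lt_trans mx; rewrite ler_nat.
apply: contrapT => /forallNP h.
have : c%:E <= limn (mu \o F).
  apply: lime_ge; first by apply/cvg_ex; exists 0.
  by apply: nearW => n /=; have /negP := h n%:R; rewrite -ltNge => /ltW.
by rewrite (cvg_lim _ Fcvg)// leNgt c0.
Qed.

Lemma bigcup_distr_gt K f (u : nat -> R) c : measurable K -> measurable_fun K f ->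
  {homo u : n m / (n <= m)%N >-> (m <= n)%R} ->
  c%:E < mu (\bigcup_n (K `&` [set x | (u n < f x)%R])) ->
  exists n, c%:E < distr K f (u n).
Proof.
move=> mK mf ndu; set F := fun n => _ => cF.
have Fcvg : mu \o F @ \oo --> mu (\bigcup_n F n).
  apply: nondecreasing_cvg_mu.
  - by move=> n; exact: measurable_superlevel.
  - by apply: bigcupT_measurable => n; exact: measurable_superlevel.
  - move=> n m nm; apply/subsetPset => x /= [Kx mx]; split=> //.
    by apply: le_lt_trans mx; exact: ndu.
apply: contrapT => /forallNP h.
have : limn (mu \o F) <= c%:E.
  apply: lime_le; first by apply/cvg_ex; exists (mu (\bigcup_n F n)).
  by apply: nearW => n /=; have /negP := h n; rewrite -leNgt.
by rewrite (cvg_lim _ Fcvg)// leNgt cF.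
Qed.

Lemma distr_gt_bottom K f c : measurable K -> measurable_fun K f ->
  c%:E < mu K -> exists l, c%:E < distr K f l.
Proof.
move=> mK mf cK.
have [||n ?] := @bigcup_distr_gt K f (fun n => - n%:R)%R c mK mf.
- by move=> n m nm; rewrite lerN2 ler_nat.
- rewrite (_ : \bigcup_n _ = K)//; apply/seteqP; split=> [x [n _ []]//|x Kx].
  exists (Num.trunc `|f x|).+1 => //; split=> //=.
  by rewrite ltrNl; apply: le_lt_trans (truncnS_gt _); rewrite -normrN ler_norm.
- by exists (- n%:R)%R.
Qed.

(** Continuity from below of the measure along the superlevel sets at
[l + 1 / (n + 1)]. *)
Lemma distr_right_continuous K f l c : measurable K -> measurable_fun K f ->
  c%:E < distr K f l -> exists2 l', (l < l')%R & c%:E < distr K f l'.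
Proof.
move=> mK mf cK.
have [||n ?] := @bigcup_distr_gt K f (fun n => l + n.+1%:R^-1)%R c mK mf.
- by move=> n m nm; rewrite lerD2l lef_pV2 ?posrE// ler_nat.
- rewrite (_ : \bigcup_n _ = K `&` [set x | (l < f x)%R])//.
  apply/seteqP; split=> [x [n _ [Kx /= lx]]|x [Kx /= lx]].
    by split=> //=; apply: lt_trans lx; rewrite ltrDl.
  have fl : (0 < f x - l)%R by rewrite subr_gt0.
  exists (Num.trunc (f x - l)^-1) => //; split=> //=.
  rewrite -ltrBrDl -[ltRHS]invrK ltf_pV2 ?posrE ?invr_gt0//.
  exact: truncnS_gt.
- by exists (l + n.+1%:R^-1)%R => //; rewrite ltrDl.
Qed.

End Distribution.

(** * The decreasing rearrangement *)

Section Rearrangement.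
Context {R : realType}.
Local Notation mu := (@completed_lebesgue_measure R).
Local Notation LR := (lebesgueR R).
Local Notation oo x y := (`]x, y[%classic : set LR).
Context (I : set R) (phi : R -> R) (a b : R).
Context (ab : a < b) (abI : (`]a, b[ `<=` I)%classic)
  (Iab : (I `<=` `[a, b])%classic) (infI : inf I = a)
  (mI : measurable (I : set LR)) (mphi : measurable_fun (I : set LR) phi).
Local Notation r := (rearrangement I phi).
Local Notation N := (distr mu (oo a b) phi).

Let mphi' : measurable_fun (oo a b) phi.
Proof. exact: measurable_funS mphi. Qed.

Let moo := @measurable_oo R.

Lemma distr_interior l : mu (I `&` [set s | l < phi s] : set LR) = N l.
Proof.
apply/eqP; rewrite eq_le; apply/andP; split; last first.
  apply: le_measure; rewrite ?inE; try exact: measurable_superlevel.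
  by apply: setSI.
apply: (@le_trans _ _ (N l + mu ([set a; b] : set R))%E); last first.
  by rewrite leb_set2 adde0.
apply: (@le_trans _ _ (mu ((oo a b `&` [set s | l < phi s]) `|` [set a; b]))).
  apply: le_measure; rewrite ?inE; first exact: measurable_superlevel.
    apply: measurableU; first exact: measurable_superlevel.
    by apply: measurableU; exact: measurable_leb.
  move=> x [Ix lx]; have [xab|] := pselect ([set a; b] x); first by right.
  move=> xab; left; split => //; rewrite -(oo_interior abI Iab).
  by split.
apply: measureU2; first exact: measurable_superlevel.
by apply: measurableU; exact: measurable_leb.
Qed.

(** The infimum defining the rearrangement inverts the distribution function;
right continuity of the latter makes the equivalence hold with strict
inequalities.  Both bounds on [t] matter: they make the set of levels nonempty
and bounded below. *)
Lemma lt_rearrangement t l : a < t < b -> (l < r t) = ((t - a)%:E < N l)%E.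
Proof.
move=> /andP[at_ tb].
have rE : r t = inf [set l | (N l <= (t - a)%:E)%E].
  rewrite /rearrangement infI; congr inf; apply/seteqP.
  by split=> x /=; rewrite distr_interior.
have abfin : (mu (oo a b) < +oo)%E by exact: leb_oo_fin (ltW ab).
have [l0 Nl0] : exists l, (N l <= (t - a)%:E)%E.
  by apply: distr_lt_top => //; rewrite lte_fin subr_gt0.
have lb l1 : ((t - a)%:E < N l1)%E -> lbound [set l | (N l <= (t - a)%:E)%E] l1.
  move=> Nl1 x /= Nx; rewrite leNgt; apply/negP => xl1.
  have := le_lt_trans Nx Nl1; rewrite ltNge => /negP; apply.
  by apply: distr_nonincreasing => //; exact: ltW.
have [l1 Nl1] : exists l, ((t - a)%:E < N l)%E.
  apply: distr_gt_bottom => //.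
  by rewrite [X in (_ < X)%E](leb_oo (ltW ab)) lte_fin ltrD2r.
rewrite rE; apply/idP/idP => [lt|tN].
  rewrite ltNge; apply/negP => Nl; move: lt; rewrite ltNge => /negP; apply.
  by apply: ge_inf => //; exists l1; exact: lb.
have [l2 ll2 Nl2] := distr_right_continuous (moo a b) mphi' tN.
by apply: lt_le_trans ll2 _; apply: lb_le_inf; [exists l0|exact: lb].
Qed.

Lemma rearrangement_superlevel l :
  oo a b `&` [set t | l < r t] = oo a (a + fine (N l)).
Proof.
have Nab : (N l <= (b - a)%:E)%E.
  rewrite -(leb_oo (ltW ab)); exact: distr_le.
have Nfin : N l \is a fin_num.
  by rewrite ge0_fin_numE ?measure_ge0// (le_lt_trans Nab) ?ltry.
apply/seteqP; split=> t /=; rewrite !in_itv/=.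
  move=> [tab]; rewrite lt_rearrangement//.
  by rewrite -{1}(fineK Nfin) lte_fin ltrBlDl => ->; case/andP: tab => ->.
move=> /andP[at_ tN]; have tab : a < t < b.
  rewrite at_ (lt_le_trans tN)// -lerBrDl -lee_fin fineK//.
by rewrite lt_rearrangement// -(fineK Nfin) lte_fin ltrBlDl.
Qed.

(** The superlevel set of the rearrangement is an initial interval whose length
is the measure of the corresponding superlevel set of [phi]. *)
Lemma distr_rearrangement l : distr mu (oo a b) r l = N l.
Proof.
have Nab : (N l <= (b - a)%:E)%E.
  rewrite -(leb_oo (ltW ab)); exact: distr_le.
have Nfin : N l \is a fin_num.
  by rewrite ge0_fin_numE ?measure_ge0// (le_lt_trans Nab) ?ltry.
have aN : a <= a + fine (N l) by rewrite lerDl fine_ge0// measure_ge0.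
rewrite /distr rearrangement_superlevel [LHS](leb_oo aN).
by rewrite addrAC subrr add0r fineK.
Qed.

Lemma rearrangement_nonincreasing s t : a < s -> s <= t -> t < b -> r t <= r s.
Proof.
move=> as_ st tb; rewrite leNgt; apply/negP => rst.
have := rst; rewrite lt_rearrangement; last by rewrite tb (lt_le_trans as_).
rewrite ltNge => /negP; apply; apply: (@le_trans _ _ (s - a)%:E); last first.
  by rewrite lee_fin lerD2r.
have := ltxx (r s); rewrite lt_rearrangement ?as_ ?(le_lt_trans st)//.
by move=> /negbT; rewrite -leNgt.
Qed.

Lemma measurable_rearrangement_interior : measurable_fun (oo a b) r.
Proof.
apply: (measurability _ (RGenOInfty.measurableE R)) => _ [_ [l ->] <-].
by rewrite preimage_itvoy rearrangement_superlevel.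
Qed.

(** At the endpoints of [I] the values are arbitrary, but the measure is
complete. *)
Lemma measurable_rearrangement : measurable_fun (I : set LR) r.
Proof.
have IE : (I : set LR) = (oo a b) `|` ((I : set LR) `&` [set a; b]).
  apply/seteqP; split=> x /=; last by case=> [/abI//|[]].
  have [xab|xab] := pselect ([set a; b] x); first by right.
  move=> Ix; left; have /seteqP[sub _] := oo_interior abI Iab.
  by apply: sub.
have m2 : measurable ((I : set LR) `&` [set a; b]).
  by apply: measurableI => //; apply: measurableU; exact: measurable_leb.
move: r measurable_rearrangement_interior => h mh.
rewrite IE; apply/(measurable_funU _ (moo a b) m2); split.
  exact: mh.
move=> _ B mB; apply: completed_lebesgue_measure_is_complete.
exists ([set a; b] : set LR); split; last by move=> x [[]].
  by apply: measurableU; exact: measurable_leb.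
exact: leb_set2.
Qed.

End Rearrangement.

(** * Exhausting an interval from inside *)

Section Shrink.
Context {R : realType}.
Local Notation mu := (@completed_lebesgue_measure R).
Local Notation LR := (lebesgueR R).
Local Notation oo x y := (`]x, y[%classic : set LR).

(** The denominator starts at [3] so that removing this length at both ends of
[[c, d]] leaves a nonempty interval. *)
Definition shrink (c d : R) (n : nat) := (d - c) / n.+3%:R.

Lemma shrink_bounds (c d : R) n : c < d ->
  0 < shrink c d n /\ shrink c d n * 3 <= d - c.
Proof.
move=> cd; have dc0 : 0 < d - c by rewrite subr_gt0.
rewrite /shrink divr_gt0//; split => //.
by rewrite mulrAC ler_pdivrMr// ler_pM2l// ler_nat.
Qed.

Lemma cvg_shrink (c d : R) : shrink c d @ \oo --> (0 : R).
Proof.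
rewrite -(mulr0 (d - c)); apply: cvgMr.
have := @cvg_harmonic R; rewrite -(cvg_shiftn 2) /=; apply: cvg_trans.
by apply: near_eq_cvg; apply: nearW => n; rewrite /= addn2.
Qed.

Lemma cvg_Rintegral_shrink (c d : R) (g : R -> R) : c < d ->
  mu.-integrable (oo c d) (EFin \o g) ->
  \int[mu]_(t in oo (c + shrink c d n) (d - shrink c d n)) g t @[n --> \oo]
    --> \int[mu]_(t in oo c d) g t.
Proof.
move=> cd ig; set s := shrink c d.
have mg : measurable_fun (oo c d) (EFin \o g) by exact: measurable_int ig.
pose A n : set LR := oo (c + s n) (d - s n).
have sub n : A n `<=` oo c d.
  have s0 : 0 < s n by have [] := shrink_bounds n cd.
  move=> t /=; rewrite !in_itv/= => /andP[h1 h2].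
  by rewrite (lt_trans _ h1) ?ltrDl// (lt_trans h2)// ltrBlDr ltrDl.
pose h n := (EFin \o g) \_ (A n).
have [] := @dominated_convergence _ _ _ mu (oo c d) (measurable_oo c d)
   h (EFin \o g) (abse \o (EFin \o g)).
- move=> n; apply/(measurable_restrict _ (measurable_oo _ _) (measurable_oo c d)).
  by apply: measurable_funS mg; [exact: measurable_oo|exact: subIsetl].
- exact: mg.
- apply: aeW => t /= tcd; apply: cvg_near_cst.
  move: tcd; rewrite in_itv/= => /andP[ct td].
  have e0 : 0 < Num.min (t - c) (d - t) by rewrite lt_min !subr_gt0 ct.
  have : \forall n \near \oo, s n < Num.min (t - c) (d - t).
    exact: (cvgr_lt _ (cvg_shrink c d)).
  apply: filterS => n; rewrite lt_min => /andP[h1 h2].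
  rewrite /h patchE mem_set// /A /= in_itv/=.
  by apply/andP; split; lra.
- exact: integrable_abse.
- apply: aeW => t n _; rewrite /h patchE; case: ifP => //= _.
  by rewrite normr0 lee_fin.
move=> _ _ lim; rewrite /Rintegral.
apply: fine_cvg; rewrite fineK; last exact: (integrable_fin_num (measurable_oo c d) ig).
apply: cvg_trans lim; apply: near_eq_cvg; apply: nearW => n /=.
rewrite /h -integral_mkcondr; congr (integral _ _ _).
by apply/setIidr; exact: sub.
Qed.

End Shrink.

(** * Oscillation of the rearrangement *)

(** The variance of a function of mean [alpha] on an interval of length [L] is
[(M - alpha) (alpha - m)] minus the mean of its gap. *)
Lemma variance_le_of_gap (R : realType) (L m M alpha w P2 : R) : 0 < L ->
  ((M - alpha) * (alpha - m) - w) * L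
    <= (M + m) * (alpha * L) - P2 - M * m * L ->
  L * P2 - (alpha * L) ^+ 2 <= w * L ^+ 2.
Proof. by move=> L0 /(ler_wpM2l (ltW L0)) h; lra. Qed.

Lemma shrink_order (R : realType) (c d e : R) : 0 < e -> e * 3 <= d - c ->
  c + e < d - e /\ d - e - (c + e) <= d - c.
Proof. by move=> e0 e3; split; lra. Qed.

Section RearrangedOscillation.
Context {R : realType}.
Local Notation mu := (@completed_lebesgue_measure R).
Local Notation LR := (lebesgueR R).
Local Notation oo x y := (`]x, y[%classic : set LR).
Context (I : set R) (phi : R -> R) (a b : R).
Context (ab : a < b) (abI : (`]a, b[ `<=` I)%classic)
  (Iab : (I `<=` `[a, b])%classic) (infI : inf I = a)
  (mI : measurable (I : set LR)) (sphi : sq_integrable mu (I : set LR) phi).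
Local Notation r := (rearrangement I phi).

Let moo := @measurable_oo R.

Let sphi' : sq_integrable mu (oo a b) phi.
Proof. by apply: sq_integrableS sphi. Qed.

Let mr : measurable_fun (oo a b) r.
Proof. by apply: measurable_rearrangement_interior => //; exact: sphi.1. Qed.

Lemma ge0_integral_rearrangement (Psi : R -> R) :
  measurable_fun setT Psi -> (forall y, 0 <= Psi y) ->
  (\int[mu]_(x in oo a b) (Psi (r x))%:E
   = \int[mu]_(x in oo a b) (Psi (phi x))%:E)%E.
Proof.
move=> mPsi Psi0; apply: ge0_integral_equimeasurable => //.
- exact: leb_oo_fin (ltW ab).
- exact: sphi'.1.
- by move=> l; apply: distr_rearrangement => //; exact: sphi.1.
Qed.

Lemma sq_integrable_rearrangement : sq_integrable mu (I : set LR) r.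
Proof.
have mrI : measurable_fun (I : set LR) r.
  by apply: (measurable_rearrangement ab abI Iab) => //; exact: sphi.1.
split => //.
have m2 : measurable_fun (I : set LR) (EFin \o (fun x => r x ^+ 2)).
  by apply/measurable_EFinP; exact: measurable_funX.
apply/integrableP; split => //.
have sq0 (x : R) : (0 <= (x ^+ 2)%:E)%E by rewrite lee_fin sqr_ge0.
under eq_integral do rewrite gee0_abs//=.
rewrite (@ge0_negligible_integral _ _ _ mu _ [set a; b] _ _ mI)//; last 2 first.
- by apply: measurableU; exact: measurable_leb.
- exact: leb_set2.
rewrite (oo_interior abI Iab).
rewrite (ge0_integral_rearrangement (exprn_measurable 2) (@sqr_ge0 _)).
have [_ /integrableP[_]] := sphi'.
by under eq_integral do rewrite gee0_abs//=.
Qed.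

Let sr : sq_integrable mu (oo a b) r.
Proof. by apply: sq_integrableS sq_integrable_rearrangement. Qed.

(** Truncating at the values of the rearrangement at [c] and [d] makes it
constant on each side of [[c, d]], so that its gap is concentrated on [[c, d]]
and [gap_integral_ge] applies to [phi].  Interior endpoints guarantee that these
two values are meaningful and finite truncation levels. *)
Lemma interior_osc_rearrangement c d (w : R) : a < c -> c < d -> d < b ->
  0 <= w -> osc_bound a b phi (d - c) w ->
  (forall eta, 0 < eta -> exists2 delta, 0 < delta & osc_bound a b phi delta eta) ->
  (d - c) * \int[mu]_(t in oo c d) (r t ^+ 2)
    - (\int[mu]_(t in oo c d) r t) ^+ 2 <= w * (d - c) ^+ 2.
Proof.
move=> ac cd db w0 osc small.
have [mphi _] := sphi.
have nir s t : a < s -> s <= t -> t < b -> r t <= r s.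
  by move=> *; exact: (rearrangement_nonincreasing ab abI Iab infI mI mphi).
pose m := r d; pose M := r c; pose L := d - c.
have L0 : 0 < L by rewrite subr_gt0.
have mM : m <= M by apply: nir => //; exact: ltW.
have left t : a < t -> t <= c -> clamp m M (r t) = M.
  by move=> at_ tc; apply: clamp_eqM => //; apply: nir => //; exact: lt_trans db.
have right t : d <= t -> t < b -> clamp m M (r t) = m.
  move=> dt tb; apply: clamp_eqm => //; apply: nir => //.
  exact: lt_trans cd.
have mid t : oo c d t -> m <= r t <= M.
  rewrite /= in_itv/= => /andP[ct td]; apply/andP; split; apply: nir.
  - exact: lt_trans ct.
  - exact: ltW.
  - by [].
  - by [].
  - exact: ltW.
  - exact: lt_trans db.
have acd : oo c d `<=` oo a b.
  move=> t; rewrite /= !in_itv/= => /andP[ct td].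
  by rewrite (lt_trans ac)// (lt_trans td).
have scd : sq_integrable mu (oo c d) r by apply: sq_integrableS sr.
have cdfin : (mu (oo c d) < +oo)%E by exact: leb_oo_fin (ltW cd).
have icd : mu.-integrable (oo c d) (EFin \o r).
  exact: sq_integrable_integrable.
have icst k : mu.-integrable (oo c d) (EFin \o cst k).
  exact: finite_integrable_cst.
have Rcst k : \int[mu]_(t in oo c d) k = k * L.
  by rewrite Rintegral_cst//; congr (_ * _); exact: len_oo (ltW cd).
pose P1 := \int[mu]_(t in oo c d) r t.
pose P2 := \int[mu]_(t in oo c d) (r t ^+ 2).
pose alpha := P1 / L.
have alphaL : alpha * L = P1 by rewrite /alpha divfK// gt_eqF.
have mP1 : m * L <= P1.
  rewrite -Rcst; apply: le_Rintegral; [by []|exact: icst|exact: icd|move=> t tcd].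
  by have /andP[] := mid _ tcd.
have P1M : P1 <= M * L.
  rewrite -Rcst; apply: le_Rintegral; [by []|exact: icd|exact: icst|move=> t tcd].
  by have /andP[] := mid _ tcd.
have malpha : m <= alpha by rewrite ler_pdivlMr.
have alphaM : alpha <= M by rewrite ler_pdivrMr.
pose Q := \int[mu]_(t in oo c d) ((M - r t) * (r t - m)).
have QE : Q = (M + m) * P1 - P2 - M * m * L.
  rewrite /Q (@eq_Rintegral _ _ _ mu _
    (fun t => - 1 * r t ^+ 2 + (M + m) * r t + - (M * m))); last first.
    by move=> t _; ring.
  rewrite (Rintegral_quadratic _ _ _ (moo c d) (leb_oo (ltW cd)) scd).
  by rewrite -/P1 -/P2 -/L; ring.
suff : ((M - alpha) * (alpha - m) - w) * L <= Q.
  rewrite -/P1 -/P2 -/L QE => h.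
  rewrite -alphaL in h *; exact: (variance_le_of_gap L0 h).
have Q0 : 0 <= Q.
  apply: Rintegral_ge0 => t /mid /andP[h1 h2].
  by rewrite mulr_ge0// subr_ge0.
(* If the mean is an extreme value, the variance vanishes and the gap is only
   needed to be nonnegative. *)
have [degenerate|] := leP ((M - alpha) * (alpha - m)) 0.
  apply: le_trans Q0; apply: mulr_le0_ge0; last exact: ltW.
  by rewrite subr_le0 (le_trans degenerate).
move=> nondegenerate.
have malpha' : m < alpha.
  rewrite lt_neqAle malpha andbT; apply/eqP => mE.
  by move: nondegenerate; rewrite mE subrr mulr0 ltxx.
have alphaM' : alpha < M.
  rewrite lt_neqAle alphaM andbT; apply/eqP => mE.
  by move: nondegenerate; rewrite mE subrr mul0r ltxx.
pose cl := clamp m M.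
have mcl : measurable_fun setT cl by exact: measurable_clamp.
have bounded_transfer (Psi : R -> R) (B : R) : measurable_fun setT Psi ->
    (forall y, 0 <= Psi y <= B) ->
    \int[mu]_(t in oo a b) Psi (phi t) =
      \int[mu]_(t in oo a c) Psi (r t) + \int[mu]_(t in oo c d) Psi (r t)
      + \int[mu]_(t in oo d b) Psi (r t).
  move=> mPsi PsiB.
  have iPsi : mu.-integrable (oo a b) (EFin \o (Psi \o r)).
    apply: (@bounded_integrable _ _ _ _ _ _ B) => //.
    - exact: leb_oo_fin (ltW ab).
    - exact: measurableT_comp mPsi mr.
    - by move=> t _ /=; have /andP[h1 h2] := PsiB (r t); rewrite ger0_norm.
  have -> : \int[mu]_(t in oo a b) Psi (phi t) = \int[mu]_(t in oo a b) Psi (r t).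
    rewrite /Rintegral ge0_integral_rearrangement// => y.
    by have /andP[] := PsiB y.
  have ad : a <= d by exact/ltW/(lt_trans ac).
  rewrite (Rintegral_split ad (ltW db) (lexx b) iPsi); congr (_ + _).
  exact: (Rintegral_split (ltW ac) (ltW cd) (ltW db) iPsi).
have Psi_mid (Psi : R -> R) :
    \int[mu]_(t in oo c d) Psi (cl (r t)) = \int[mu]_(t in oo c d) Psi (r t).
  apply: eq_Rintegral => t; rewrite inE => /mid tcd.
  by rewrite /cl clamp_id.
have cl_ge y : m <= cl y := clamp_ge m M y.
have cl_le y : cl y <= M := clamp_le y mM.
rewrite {1}/L; apply: le_trans (gap_integral_ge ab sphi' L0 _ malpha' alphaM'
  w0 osc small _ _) _.
- by apply: lerB; exact: ltW.
- rewrite (@bounded_transfer (fun y => cl y - m) (M - m)); last 2 first.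
  + exact: measurable_funB.
  + by move=> y; rewrite subr_ge0 cl_ge lerD2r cl_le.
  rewrite (Psi_mid (fun y => y - m)) (RintegralB (moo c d) icd (icst m)) Rcst -/P1 -alphaL -mulrBl.
  rewrite -addrA addrCA lerDl; apply: addr_ge0;
    by apply: Rintegral_ge0 => t _; rewrite subr_ge0.
- rewrite (@bounded_transfer (fun y => M - cl y) (M - m)); last 2 first.
  + exact: measurable_funB.
  + by move=> y; rewrite subr_ge0 cl_le lerD2l lerN2 cl_ge.
  rewrite (Psi_mid (fun y => M - y)) (RintegralB (moo c d) (icst M) icd) Rcst -/P1 -alphaL -mulrBl.
  rewrite -addrA addrCA lerDl; apply: addr_ge0;
    by apply: Rintegral_ge0 => t _; rewrite subr_ge0.
- rewrite (@bounded_transfer (fun y => (M - cl y) * (cl y - m))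
    ((M - m) * (M - m))); last 2 first.
  + by apply: measurable_funM; exact: measurable_funB.
  + move=> y; rewrite mulr_ge0 ?subr_ge0//=.
    by apply: ler_pM; rewrite ?subr_ge0// ?lerD2l ?lerD2r ?lerN2.
  rewrite (Psi_mid (fun y => (M - y) * (y - m))) -/Q.
  rewrite (@eq_Rintegral _ _ _ mu (oo a c) (fun=> 0)); last first.
    move=> t; rewrite inE /= in_itv/= => /andP[at_ tc].
    by rewrite /cl left ?(ltW tc)// subrr mul0r.
  rewrite (@eq_Rintegral _ _ _ mu (oo d b) (fun=> 0)); last first.
    move=> t; rewrite inE /= in_itv/= => /andP[dt tb].
    by rewrite /cl right ?(ltW dt)// subrr mulr0.
  by rewrite !Rintegral_cst// !mul0r addr0 add0r.
Qed.

(** The rearrangement can be unbounded at the ends of [I], where there is no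
finite truncation level; the inequality passes to the limit along interior
intervals. *)
Lemma osc_rearrangement c d (w : R) : a <= c -> c < d -> d <= b ->
  0 <= w -> osc_bound a b phi (d - c) w ->
  (forall eta, 0 < eta -> exists2 delta, 0 < delta & osc_bound a b phi delta eta) ->
  (d - c) * \int[mu]_(t in oo c d) (r t ^+ 2)
    - (\int[mu]_(t in oo c d) r t) ^+ 2 <= w * (d - c) ^+ 2.
Proof.
move=> ac cd db w0 osc small.
have cdab : oo c d `<=` oo a b.
  move=> t; rewrite /= !in_itv/= => /andP[ct td].
  by rewrite (le_lt_trans ac)// (lt_le_trans td).
have scd : sq_integrable mu (oo c d) r by apply: sq_integrableS sr.
have icd : mu.-integrable (oo c d) (EFin \o r).
  by apply: sq_integrable_integrable => //; exact: leb_oo_fin (ltW cd).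
set s := shrink c d.
pose V n := (d - s n - (c + s n)) *
    \int[mu]_(t in oo (c + s n) (d - s n)) (r t ^+ 2)
  - (\int[mu]_(t in oo (c + s n) (d - s n)) r t) ^+ 2.
have cvgV : V n @[n --> \oo] --> (d - c) * \int[mu]_(t in oo c d) (r t ^+ 2)
    - (\int[mu]_(t in oo c d) r t) ^+ 2.
  have s0 := cvg_shrink c d.
  apply: cvgB; last first.
    have c1 := cvg_Rintegral_shrink cd icd.
    by rewrite expr2; exact: (cvgM c1 c1).
  apply: cvgM; last exact: (cvg_Rintegral_shrink cd scd.2).
  rewrite -[d in X in _ --> X]subr0 -[c in X in _ --> X]addr0.
  by apply: cvgB; [apply: cvgB s0|apply: cvgD s0]; exact: cvg_cst.
rewrite -(cvg_lim _ cvgV)//; apply: limr_le; first by apply/cvg_ex; eexists; exact: cvgV.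
apply: nearW => n; have [sn0 sn3] := shrink_bounds n cd.
have {}sn0 : 0 < s n by [].
have {}sn3 : s n * 3 <= d - c by [].
rewrite /V; clearbody s; move: (s n) sn0 sn3 => e e0 e3.
have [ce eL] := shrink_order e0 e3.
apply: le_trans (_ : w * (d - e - (c + e)) ^+ 2 <= _).
  apply: interior_osc_rearrangement => //.
  - by rewrite (le_lt_trans ac)// ltrDl.
  - by rewrite (lt_le_trans _ db)// ltrBlDr ltrDl.
  - by move=> x y ax xy yb yx; apply: osc => //; exact: le_trans eL.
apply: ler_wpM2l => //.
by rewrite lerXn2r// nnegrE ?subr_ge0 ltW.
Qed.

End RearrangedOscillation.

(** * The Campanato norm *)

Section Campanato.
Context {R : realType}.
Local Notation mu := (@completed_lebesgue_measure R).
Local Notation LR := (lebesgueR R).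
Local Notation oo x y := (`]x, y[%classic : set LR).
Implicit Types (I J : set R) (xi f phi : R -> R) (C : R).

Lemma modulus_on_monotone (T : R) xi : modulus_on T xi ->
  forall s t, 0 <= s -> s <= t -> t <= T -> 0 <= xi s <= xi t.
Proof.
move=> [eta [_ ndeta eta0 _] xiE] s t s0 st tT.
have t0 := le_trans s0 st.
rewrite !xiE ?in_itv/= ?s0 ?t0 ?(le_trans st)//.
by rewrite eta0//= ndeta ?in_itv/= ?s0 ?t0.
Qed.

(** Right continuity of the modulus at [0]; the value at [0] itself is handled
apart, since the limit is taken over positive points. *)
Lemma modulus_on_small (T C e : R) xi : modulus_on T xi -> 0 < e ->
  exists2 delta, 0 < delta &
    forall t, 0 <= t -> t <= T -> t <= delta -> C ^+ 2 * xi t ^+ 2 <= e.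
Proof.
move=> [eta [ceta _ eta_ge0 eta0] xiE] e0.
pose k := Num.sqrt e / (`|C| + 1).
have C0 : 0 < `|C| + 1 by rewrite ltr_wpDl.
have k0 : 0 < k by rewrite divr_gt0// sqrtr_gt0.
have [_ eta_right] := (continuous_within_itvcyP 0 eta).1 ceta.
have : \forall t \near (0 : R)^'+, eta t < k.
  by apply: (cvgr_lt _ eta_right); rewrite eta0.
rewrite near_withinE => /nbhs_ballP[d /= d0 near0].
exists (d / 2); first by rewrite divr_gt0.
move=> t t0 tT td; rewrite xiE ?in_itv/= ?t0//.
have etak : eta t < k.
  move: t0; rewrite le_eqVlt => /predU1P[<-|t0]; first by rewrite eta0.
  apply: near0 => //; rewrite /ball/= sub0r normrN gtr0_norm//.
  by rewrite (le_lt_trans td)// ltr_pdivrMr// ltr_pMr// ltr1n.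
rewrite -exprMn -[leRHS]sqr_sqrtr ?(ltW e0)//.
rewrite -[leLHS]real_normK ?num_real//.
rewrite lerXn2r ?nnegrE ?sqrtr_ge0// normrM (ger0_norm (eta_ge0 _ t0)).
have -> : Num.sqrt e = (`|C| + 1) * k by rewrite /k mulrC divfK// gt_eqF.
by apply: ler_pM => //; [exact: eta_ge0|rewrite lerDl|exact: ltW].
Qed.

Lemma measurable_interval I : is_interval I -> measurable (I : set LR).
Proof. by move=> iI; apply: measurable_leb; exact: is_interval_measurable. Qed.

Lemma avg_interior J f c d : measurable (J : set LR) ->
  (`]c, d[ `<=` J)%classic -> (J `<=` `[c, d])%classic -> len J = d - c ->
  mu.-integrable (J : set LR) (EFin \o f) ->
  avg J f = (d - c)^-1 * \int[mu]_(t in oo c d) f t.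
Proof. by move=> mJ h1 h2 lJ iJ; rewrite /avg lJ (Rintegral_interior mJ h1 h2). Qed.

Lemma variance_scale (l P1 P2 v : R) : 0 < l ->
  (l^-1 * P2 - (l^-1 * P1) ^+ 2 <= v) = (l * P2 - P1 ^+ 2 <= v * l ^+ 2).
Proof.
move=> l0; rewrite -(ler_pM2r (exprn_gt0 2 l0)); congr (_ <= _).
by field; rewrite gt_eqF.
Qed.

Lemma subset_ends (a b c d : R) : c < d -> (`]c, d[ `<=` `[a, b])%classic ->
  a <= c /\ d <= b.
Proof.
move=> cd sub; split; rewrite leNgt; apply/negP => h.
- pose e := Num.min a d.
  have ce : c < e by rewrite lt_min h cd.
  have ea : e <= a by rewrite ge_min lexx.
  have ed : e <= d by rewrite ge_min lexx orbT.
  have : `[a, b]%classic ((c + e) / 2) by apply: sub; rewrite /= in_itv/=; lra.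
  by rewrite /= in_itv/=; lra.
- pose e := Num.max b c.
  have ed : e < d by rewrite gt_max h cd.
  have be : b <= e by rewrite le_max lexx.
  have ce : c <= e by rewrite le_max lexx orbT.
  have : `[a, b]%classic ((e + d) / 2) by apply: sub; rewrite /= in_itv/=; lra.
  by rewrite /= in_itv/=; lra.
Qed.

(** Monotonicity of [xi] turns the bound at the length of each window into one
bound for all windows that are not longer than the given interval. *)
Lemma Lxi_bound_rearrangement I xi phi C :
  finite_interval I -> modulus_on (len I) xi ->
  sq_integrable mu (I : set LR) phi ->
  Lxi_bound xi I phi C -> Lxi_bound xi I (rearrangement I phi) C.
Proof.
move=> fI mxi sphi bound.
have mI := measurable_interval fI.1.
have Ifin : (mu (I : set LR) < +oo)%E by have [_ /andP[]] := fI.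
have [a [b [ab abI Iab infI lenI]]] := finite_interval_ends fI.
rewrite lenI in mxi.
have sr := sq_integrable_rearrangement ab abI Iab infI mI sphi.
have ooI x y : a <= x -> y <= b -> (`]x, y[ `<=` I)%classic.
  move=> ax yb t /=; rewrite in_itv/= => /andP[xt ty]; apply: abI.
  by rewrite /= in_itv/= (le_lt_trans ax)// (lt_le_trans ty).
have sub_int J f : measurable (J : set LR) -> (J `<=` I)%classic ->
    sq_integrable mu (I : set LR) f ->
    mu.-integrable (J : set LR) (EFin \o f) /\
    mu.-integrable (J : set LR) (EFin \o (fun x => f x ^+ 2)).
  move=> mJ JI sf; split; last exact: (integrableS mI mJ JI sf.2).
  exact: (integrableS mI mJ JI (sq_integrable_integrable mI Ifin sf)).
have window x y : a <= x -> x < y -> y <= b ->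
    (y - x) * \int[mu]_(t in oo x y) (phi t ^+ 2)
    - (\int[mu]_(t in oo x y) phi t) ^+ 2
    <= C ^+ 2 * xi (y - x) ^+ 2 * (y - x) ^+ 2.
  move=> ax xy yb; rewrite -variance_scale ?subr_gt0//.
  have := bound _ (finite_interval_oo xy) (ooI _ _ ax yb).
  by rewrite /avg len_oo// ltW.
have small e : 0 < e -> exists2 delta, 0 < delta & osc_bound a b phi delta e.
  move=> e0; have [delta delta0 Hdelta] := modulus_on_small C mxi e0.
  exists delta => // x y ax xy yb yx; apply: (le_trans (window x y ax xy yb)).
  apply: ler_wpM2r; first exact: sqr_ge0.
  apply: Hdelta => //; first by rewrite subr_ge0 ltW.
  by rewrite lerB.
move=> J fJ JI.
have mJ := measurable_interval fJ.1.
have [c [d [cd cdJ Jcd _ lenJ]]] := finite_interval_ends fJ.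
have [ac db] : a <= c /\ d <= b.
  by apply: subset_ends cd _ => t /cdJ/JI/Iab.
have [i1 i2] := sub_int _ _ mJ JI sr.
rewrite (avg_interior mJ cdJ Jcd lenJ i1) (avg_interior mJ cdJ Jcd lenJ i2) lenJ.
rewrite variance_scale ?subr_gt0//.
apply: (osc_rearrangement ab abI Iab infI mI sphi) => //.
  by rewrite mulr_ge0// sqr_ge0.
move=> x y ax xy yb yx; apply: (le_trans (window x y ax xy yb)).
apply: ler_wpM2r; first exact: sqr_ge0.
apply: ler_wpM2l; first exact: sqr_ge0.
have /andP[xi0 xile] : 0 <= xi (y - x) <= xi (d - c).
  apply: (modulus_on_monotone mxi); [by rewrite subr_ge0 ltW|exact: yx|].
  exact: lerB.
by rewrite lerXn2r ?nnegrE// (le_trans xi0).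
Qed.

End Campanato.

Theorem theorem1p3 (R : realType) (I : set R) (xi phi : R -> R) :
  finite_interval I -> modulus_on (len I) xi -> Lxi xi I phi ->
  Lxi xi I (rearrangement I phi) /\
  (Lxi_norm xi I (rearrangement I phi) <= Lxi_norm xi I phi)%E.
Proof.
move=> fI mxi [mphi iphi2 normfin].
have sphi : sq_integrable leb (I : set (lebesgueR R)) phi by [].
have norm_le : (Lxi_norm xi I (rearrangement I phi) <= Lxi_norm xi I phi)%E.
  apply: ereal_inf_le_tmp => _ [C [C0 bound] <-]; exists C => //; split => //.
  exact: Lxi_bound_rearrangement.
split; last exact: norm_le.
have [a [b [ab abI Iab infI _]]] := finite_interval_ends fI.
have mI := measurable_interval fI.1.
have [mr ir] := sq_integrable_rearrangement ab abI Iab infI mI sphi.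
by split; [exact: mr|exact: ir|exact: le_lt_trans normfin].
Qed.
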